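(* Let $r\ge 2$, $n\ge1$ and $0\le k\le n$ be integers. The collection $\mathcal{D}_{n,k}$ of $(n,k)$-descent monomials descends to a vector space basis of the quotient ring $S_{n,k}$.
   Context: Let $e_d(\mathbf{x}_n^r)=e_d(x_1^r,\dots,x_n^r)$ be the $d$-th elementary symmetric polynomial in $x_1^r,\dots,x_n^r$, let $$J_{n,k}=\langle x_1^{kr},\dots,x_n^{kr},e_n(\mathbf{x}_n^r),e_{n-1}(\mathbf{x}_n^r),\dots,e_{n-k+1}(\mathbf{x}_n^r)\rangle\subseteq\mathbb{C}[x_1,\dots,x_n]$$ and $S_{n,k}=\mathbb{C}[x_1,\dots,x_n]/J_{n,k}$. Let $G_n$ be the set of $r$-colored permutations $g=\pi_1^{c_1}\cdots\pi_n^{c_n}$, where $\pi_1\cdots\pi_n\in\mathfrak{S}_n$ and $c_i\in\{0,1,\dots,r-1\}$. Order colored letters by $$1^{r-1}<2^{r-1}<\cdots<1^{r-2}<2^{r-2}<\cdots<1^0<2^0<\cdots$$ (a higher color is smaller; within a color, order by letter value). Set $\mathrm{Des}(g)=\{1\le i\le n-1:\pi_i^{c_i}>\pi_{i+1}^{c_{i+1}}\}$, $\mathrm{des}(g)=|\mathrm{Des}(g)|$, $d_i(g)=|\{j\in\mathrm{Des}(g):j\ge i\}|$, and define the descent monomial $$b_g=\prod_{i=1}^n x_{\pi_i}^{r d_i(g)+c_i}.$$ $\mathcal{D}_{n,k}$ is the set of all monomials of the form $b_g\cdot x_{\pi_1}^{ri_1}\cdots x_{\pi_{n-k}}^{ri_{n-k}}$,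 where $g=\pi_1^{c_1}\cdots\pi_n^{c_n}\in G_n$ satisfies $\mathrm{des}(g)<k$ and $(i_1,\dots,i_{n-k})$ is an integer sequence with $k-\mathrm{des}(g)>i_1\ge\cdots\ge i_{n-k}\ge0$. A set of monomials descends to a basis of a quotient if the cosets of its elements are pairwise distinct and form a basis. *)

(* Defs.v *)
From HB Require Import structures.
From mathcomp Require Import all_boot all_order all_algebra perm.
From mathcomp Require Import generic_quotient ring_quotient.
From mathcomp Require Import boolp classical_sets reals.
From mathcomp Require Import complex mpoly.

Set Implicit Arguments.
Unset Strict Implicit.
Unset Printing Implicit Defensive.

Import GRing.Theory.

Local Open Scope ring_scope.
Local Open Scope quotient_scope.

(* MathComp's quotient by an ideal requires a decidable (boolean) membership
   predicate, and a proper ideal to get a ring structure; it provides no module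
   structure.  Here membership in <s> is made boolean classically, and the
   quotient A / <s> is given its structure of (possibly trivial) commutative
   ring and of K-module. *)
Section IdealQuotient.
Variables (K : comNzRingType) (A : comAlgType K) (s : seq A).

Definition ideal_gen : {pred A} :=
  fun p => `[< exists c : 'I_(size s) -> A, p = \sum_(i < size s) c i * s`_i >].

Lemma ideal_genP p :
  reflect (exists c : 'I_(size s) -> A, p = \sum_(i < size s) c i * s`_i)
          (p \in ideal_gen).
Proof. exact: asboolP. Qed.

Lemma ideal_gen_zmod_closed : zmod_closed ideal_gen.
Proof.
split=> [|p q /ideal_genP[c ->] /ideal_genP[d ->]]; apply/ideal_genP.
  by exists (fun=> 0); rewrite big1 // => i _; rewrite mul0r.
exists (fun i => c i - d i); rewrite -sumrB.
by apply: eq_bigr => i _; rewrite mulrBl.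
Qed.

HB.instance Definition _ :=
  GRing.isZmodClosed.Build A ideal_gen ideal_gen_zmod_closed.

Lemma ideal_genMr a p : p \in ideal_gen -> a * p \in ideal_gen.
Proof.
move=> /ideal_genP[c ->]; apply/ideal_genP; exists (fun i => a * c i).
by rewrite mulr_sumr; apply: eq_bigr => i _; rewrite mulrA.
Qed.

Lemma ideal_genZ (a : K) p : p \in ideal_gen -> a *: p \in ideal_gen.
Proof. by move=> Ip; rewrite -[p]mul1r scalerAl ideal_genMr. Qed.

Definition gen_quot : Type := Quotient.quot ideal_gen.
HB.instance Definition _ := Choice.on gen_quot.
HB.instance Definition _ := GRing.Zmodule.on gen_quot.
HB.instance Definition _ : EqQuotient A (Quotient.equiv ideal_gen) gen_quot :=
  EqQuotient.on gen_quot.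
HB.instance Definition _ :
  isZmodQuotient A (Quotient.equiv ideal_gen) 0 -%R +%R gen_quot :=
  ZmodQuotient.on gen_quot.

Lemma pi_eq (p q : A) :
  \pi_gen_quot p = \pi_gen_quot q <-> p - q \in ideal_gen.
Proof. by split=> [/eqP|H]; [|apply/eqP]; rewrite -Quotient.idealrBE. Qed.

Definition gone : gen_quot := \pi_gen_quot 1.
Definition gmul (x y : gen_quot) : gen_quot := \pi_gen_quot (repr x * repr y).
Definition gscale (a : K) (x : gen_quot) : gen_quot := \pi_gen_quot (a *: repr x).

Lemma repr_pi (p : A) : repr (\pi_gen_quot p) - p \in ideal_gen.
Proof. by apply/pi_eq; rewrite reprK. Qed.

Lemma gmulE p q : gmul (\pi p) (\pi q) = \pi_gen_quot (p * q).
Proof.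
apply/pi_eq; set u := repr _; set v := repr _.
have -> : u * v - p * q = v * (u - p) + p * (v - q).
  by rewrite !mulrBr mulrC addrA [v * p]mulrC subrK.
by rewrite rpredD // ideal_genMr // repr_pi.
Qed.

Lemma gscaleE a p : gscale a (\pi p) = \pi_gen_quot (a *: p).
Proof. by apply/pi_eq; rewrite -scalerBr ideal_genZ // repr_pi. Qed.

Lemma gaddE p q : \pi_gen_quot p + \pi q = \pi_gen_quot (p + q).
Proof. by rewrite pi_addr. Qed.

Lemma gmulA : associative gmul.
Proof. by elim/quotW=> x; elim/quotW=> y; elim/quotW=> z; rewrite !gmulE mulrA. Qed.

Lemma gmulC : commutative gmul.
Proof. by elim/quotW=> x; elim/quotW=> y; rewrite !gmulE mulrC. Qed.

Lemma gmul1 : left_id gone gmul.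
Proof. by elim/quotW=> x; rewrite gmulE mul1r. Qed.

Lemma gmulDl : left_distributive gmul +%R.
Proof.
by elim/quotW=> x; elim/quotW=> y; elim/quotW=> z; rewrite !(gaddE, gmulE) mulrDl.
Qed.

HB.instance Definition _ :=
  GRing.Zmodule_isComPzRing.Build gen_quot gmulA gmulC gmul1 gmulDl.

Lemma gscaleA a b x : gscale a (gscale b x) = gscale (a * b) x.
Proof. by elim/quotW: x => x; rewrite !gscaleE scalerA. Qed.

Lemma gscale1 : left_id 1 gscale.
Proof. by elim/quotW=> x; rewrite gscaleE scale1r. Qed.

Lemma gscaleDr : right_distributive gscale +%R.
Proof. by move=> a; elim/quotW=> x; elim/quotW=> y; rewrite !(gaddE, gscaleE) scalerDr. Qed.

Lemma gscaleDl x : {morph gscale^~ x : a b / a + b}.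
Proof. by move=> a b; elim/quotW: x => x; rewrite !gscaleE gaddE scalerDl. Qed.

HB.instance Definition _ := GRing.Zmodule_isLmodule.Build K gen_quot
  gscaleA gscale1 gscaleDr gscaleDl.

Lemma pi_gen_quot_is_linear : linear (\pi_gen_quot : A -> gen_quot).
Proof. by move=> a p q; rewrite -gaddE -gscaleE. Qed.

Lemma pi_gen_quot_is_monoid_morphism :
  monoid_morphism (\pi_gen_quot : A -> gen_quot).
Proof. by split=> // p q; rewrite -gmulE. Qed.

Lemma gen_quot_scaleAl (a : K) (x y : gen_quot) : a *: (x * y) = (a *: x) * y.
Proof.
elim/quotW: x => x; elim/quotW: y => y.
by rewrite /GRing.scale /GRing.mul /= !(gmulE, gscaleE) scalerAl.
Qed.

End IdealQuotient.

Section Basis.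
Variables (K : nzRingType) (V : lmodType K).

Definition lin_indep (B : set V) : Prop :=
  forall (m : nat) (v : 'I_m -> V) (c : 'I_m -> K),
    injective v -> (forall i, B (v i)) ->
    \sum_(i < m) c i *: v i = 0 -> forall i, c i = 0.

Definition spanning (B : set V) : Prop :=
  forall w : V, exists (m : nat) (v : 'I_m -> V) (c : 'I_m -> K),
    (forall i, B (v i)) /\ w = \sum_(i < m) c i *: v i.

Definition is_basis (B : set V) : Prop := lin_indep B /\ spanning B.

End Basis.

Definition descends_to_basis (K : nzRingType) (A : Type) (V : lmodType K)
    (proj : A -> V) (D : set A) : Prop :=
  (forall p q, D p -> D q -> proj p = proj q -> p = q)
  /\ is_basis (proj @` D)%classic.

Section Ideal.
Variables (K : comNzRingType) (r n k : nat).

Definition esym_pow (d : nat) : {mpoly K[n]} :=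
  mesym n K d \mPo [tuple 'X_i ^+ r | i < n].

Definition J_gens : seq {mpoly K[n]} :=
  [seq 'X_i ^+ (k * r) | i : 'I_n] ++ [seq esym_pow (n - j) | j <- iota 0 k].

Definition S_nk : Type := gen_quot J_gens.
HB.instance Definition _ := GRing.ComPzRing.on S_nk.
HB.instance Definition _ := GRing.Lmodule.on S_nk.

Definition to_S_nk : {mpoly K[n]} -> S_nk := \pi_(gen_quot J_gens).

End Ideal.

Arguments to_S_nk K r n k _ : clear implicits.

(* (pi, c) stands for pi_1^{c_1} ... pi_n^{c_n}, with positions and letters
   shifted to 0, ..., n - 1. *)
Definition colored_perm (r n : nat) := ('S_n * {ffun 'I_n -> 'I_r})%type.

Section Descents.
Variables (r n : nat) (g : colored_perm r n).

Definition perm_of : 'S_n := g.1.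
Definition color_of : {ffun 'I_n -> 'I_r} := g.2.

Definition letter_lt (a b : 'I_n * 'I_r) : bool :=
  (b.2 < a.2)%N || (a.2 == b.2) && (a.1 < b.1)%N.

Definition letter (i : 'I_n) : 'I_n * 'I_r := (perm_of i, color_of i).

Definition Des : {set 'I_n} :=
  [set i : 'I_n | [exists j : 'I_n,
     (j == i.+1 :> nat) && letter_lt (letter j) (letter i)]].

Definition des : nat := #|Des|.

Definition d_ (i : 'I_n) : nat := #|[set j in Des | (i <= j)%N]|.

Definition descent_monomial (K : comNzRingType) : {mpoly K[n]} :=
  \prod_(i < n) 'X_(perm_of i) ^+ (r * d_ i + color_of i).

End Descents.

(* The condition k - des g > i_1 is void when n = k, the sequence being empty. *)
Definition D_nk (K : comNzRingType) (r n k : nat) : set {mpoly K[n]} :=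
  [set p | exists (g : colored_perm r n) (e : (n - k).-tuple nat),
     [/\ (des g < k)%N,
         sorted geq e,
         all (fun x => x < k - des g)%N e
       & p = descent_monomial g K *
             \prod_(j < n - k)
               'X_(perm_of g (widen_ord (leq_subr k n) j)) ^+ (r * tnth e j)]]%classic.

Arguments D_nk K r n k _ : clear implicits.

(* Main.v *)
From HB Require Import structures.
Require Import Defs.
From mathcomp Require Import all_boot all_algebra reals complex mpoly.
From mathcomp Require Import perm zify boolp separable cyclotomic.

(** The descent monomials span the quotient, by straightening, and they are
independent in it, because there are no more of them than points of a set on
which the generators of [J] collapse to polynomials of lower degree.

Spanning ([straighten_cases], [straighten_ind], [straighten]).  List the letters
of a monomial [x^m] by decreasing exponent, small letters first among equal
exponents; write [m_x = r q_x + c_x] with [c_x < r], and let [g] be the listing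
colored by [c].  Along the listing, [q] drops by at least one at each descent of
[g], so [q - d] is weakly decreasing and nonnegative.  If some [m_x >= k r], the
monomial is in [J].  If [q - d] vanishes outside the first [n - k] positions, the
monomial is a descent monomial.  Otherwise let [l > n - k] be the last position
with [q - d > 0] and [A] the first [l] letters: then [x^m] is the term of [A] in
the product of [x^m / x_A^r] with [e_l(x^r)], a multiple of a generator of [J],
and every other term of that product has a smaller [potential].

Counting ([card_descent_data]).  Let [Y] be the set of maps from the letters to
[k] colored blocks that hit every block.  For a fixed [g] with [d] descents there
are ['C(n - 1 - d, n - k)] sequences to go with [g], as many as ways of
deleting [n - k] of the [n - 1 - d] ascents of [g].  Reading the
positions of [g] as letters, with a bar at each gap that is kept, gives a
point of [Y]; it determines [g] and the gaps, since the letters of a block are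
listed in increasing colored order.

Independence ([lowered_J_generator], [ev_descent_span], [ev_descent_free],
[dual_ideal]).  Realize [Y] by points in affine space, the colors of block [j]
being [r] distinct [r]-th roots of a number [alpha_j].  Each [x_i^r] is
then a root of [prod_j (T - alpha_j)], and this polynomial divides
[prod_i (T - x_i^r)]; hence, on [Y], every generator of [J] agrees with a
polynomial of smaller degree.  Straightening, by induction on the degree, now
shows that descent monomials of degree less than [e] span the restrictions to
[Y] of all polynomials of degree less than [e].  By interpolation these are all
functions on [Y]; being at most as many as the points, the descent monomials are
linearly independent on [Y].  Finally, the coordinate along a descent monomial
of degree [e] of the restriction to [Y] of the component of degree [e] is a
linear form that vanishes on [J], and these forms are dual to the descent
monomials. *)

Set Implicit Arguments.
Unset Strict Implicit.
Unset Printing Implicit Defensive.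

(** * Listing letters by exponent *)

Section SortingByExponent.
Variable n : nat.
Implicit Types (a : 'I_n -> nat) (s : 'S_n) (x y : 'I_n).

(** Comparing keys compares exponents first, a smaller letter winning ties.  A
numerical encoding is used because the potential of a monomial changes by keys. *)
Definition key a x := a x * n + (n.-1 - x).

Definition sorts a s := forall i j : 'I_n, i < j -> key a (s j) < key a (s i).

Lemma key_inj a : injective (key a).
Proof.
move=> x y; rewrite /key => e; apply/val_inj => /=.
have := ltn_ord x; have := ltn_ord y.
have [lt|lt|ee] := ltngtP (a x) (a y); nia.
Qed.

(** The position of a letter in the listing counts the letters of larger key, so
the listing is determined by the exponents. *)
Lemma sorts_card a s : sorts a s ->
  forall i, #|[set y | key a (s i) < key a y]| = i.
Proof.
move=> hs i; rewrite -[RHS](card_ord i).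
have -> : [set y | key a (s i) < key a y] = (s \o widen_ord (ltnW (ltn_ord i))) @: 'I_i.
  apply/setP => y; rewrite inE; apply/idP/imsetP => [h|[j _ ->]].
    have lt : s^-1%g y < i.
      rewrite ltnNge leq_eqVlt; apply/negP => /orP[/eqP/val_inj e|/hs].
        by rewrite e permKV ltnn in h.
      by rewrite permKV => /ltn_trans/(_ h); rewrite ltnn.
    exists (Ordinal lt) => //=; apply: (@perm_inj _ s^-1%g).
    by rewrite permK; apply: val_inj.
  by apply: hs; apply: (ltn_ord j).
rewrite card_imset // => j1 j2 /perm_inj/(congr1 val) /= e.
exact/val_inj.
Qed.

Lemma sorts_uniq a s t : sorts a s -> sorts a t -> s = t.
Proof.
move=> hs ht; apply/permP => i.
have := sorts_card ht (t^-1%g (s i)); rewrite permKV sorts_card // => /val_inj e.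
by rewrite {2}e permKV.
Qed.

Lemma sorts_exists a : exists s, sorts a s.
Proof.
pose rk x := #|[set y | key a x < key a y]|.
have rk_lt x : rk x < n.
  rewrite -[X in _ < X](card_ord n) -cardsT; apply: proper_card.
  by apply/properP; split; [apply: subsetT|exists x; rewrite ?inE ?ltnn].
have rk_homo x y : key a y < key a x -> rk x < rk y.
  move=> h; apply: proper_card; apply/properP; split.
    by apply/subsetP => u; rewrite !inE => /(ltn_trans h).
  by exists x; rewrite ?inE ?ltnn.
have rk_inj : injective (fun x => Ordinal (rk_lt x)).
  move=> x y /(congr1 val) /= e; apply: (@key_inj a).
  by case: (ltngtP (key a x) (key a y)) => // /rk_homo; rewrite e ltnn.
exists ((perm rk_inj)^-1)%g => i j ij; rewrite ltnNge leq_eqVlt.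
apply/negP => /orP[/eqP/key_inj/perm_inj e|/rk_homo h]; first by rewrite e ltnn in ij.
have E x : rk ((perm rk_inj)^-1%g x) = x.
  by rewrite -{2}(permKV (perm rk_inj) x) [in RHS]permE.
by rewrite !E in h; lia.
Qed.

Lemma ord_homo (R : rel nat) (F : 'I_n -> nat) : transitive R ->
    (forall i j : 'I_n, j = i.+1 :> nat -> R (F i) (F j)) ->
  forall i j : 'I_n, i < j -> R (F i) (F j).
Proof.
move=> tr st i [j hj] /=; elim: j hj => // j IH hj; rewrite ltnS leq_eqVlt.
move=> /orP[/eqP e|lt]; first by apply: st; rewrite /= e.
by apply: (tr (F (Ordinal (ltnW hj)))); [apply: IH|apply: st].
Qed.

(** After the common part is removed, both sets have the same number of elements
left, and each one left in [A] beats each one left in [B]. *)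
Lemma sum_top_set (F : 'I_n -> nat) (A B : {set 'I_n}) :
    #|B| = #|A| -> B != A ->
    (forall x y, x \in A -> y \notin A -> F y < F x) ->
  \sum_(x in B) F x < \sum_(x in A) F x.
Proof.
move=> cAB nAB h.
have cD : #|A :\: B| = #|B :\: A|.
  by apply: (@addnI #|A :&: B|); rewrite cardsID setIC cardsID.
have ne : 0 < #|A :\: B|.
  rewrite card_gt0; apply: contraNneq nAB => e.
  have sAB : A \subset B by rewrite -setD_eq0 e.
  by rewrite eq_sym eqEcard sAB cAB leqnn.
rewrite (big_setID A) [X in _ < X](big_setID B) /= setIC ltn_add2l.
have /card_gt0P[x0 hx0] := ne.
pose x1 := [arg min_(x < x0 in A :\: B) F x].
have [hx1 mx1] : x1 \in A :\: B /\ forall x, x \in A :\: B -> F x1 <= F x.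
  by rewrite /x1; case: arg_minnP.
have [hx1A hx1B] : x1 \in A /\ x1 \notin B by move: hx1; rewrite inE => /andP[].
apply: (@leq_trans (#|A :\: B| * F x1)); last first.
  by rewrite -sum_nat_const; apply: leq_sum.
have [F0|F0] := posnP (F x1).
  have /card_gt0P[y] : 0 < #|B :\: A| by rewrite -cD.
  by rewrite inE => /andP[/(h _ _ hx1A)]; rewrite F0.
apply: (@leq_ltn_trans (#|B :\: A| * (F x1).-1)).
  rewrite -sum_nat_const; apply: leq_sum => y; rewrite inE => /andP[/(h _ _ hx1A)].
  by lia.
by rewrite cD ltn_pmul2l ?ltn_predL // -cD.
Qed.

End SortingByExponent.

(** * Descents of colored permutations *)

Section Descents.
Variables r n : nat.
Implicit Types (g : colored_perm r n) (i j x y : 'I_n) (b c : 'I_r).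

(** For exponents [r * p + b] and [r * q + c], the listing order says exactly that
the quotient drops, by at least one when the colored letters form a descent.
Both directions matter: one extracts [g] from a monomial, the other recovers the
listing from a point. *)
Lemma key_step x y b c p q : x != y ->
  ((r * q + c) * n + (n.-1 - y) < (r * p + b) * n + (n.-1 - x))
  = (q + letter_lt (y, c) (x, b) <= p).
Proof.
move=> nxy; rewrite /letter_lt /=.
have hn : n = n.-1.+1 by have := ltn_ord x; lia.
have hx : x <= n.-1 by rewrite -ltnS -hn.
have hy : y <= n.-1 by rewrite -ltnS -hn.
have hlex u v : (u * n + (n.-1 - y) < v * n + (n.-1 - x)) = (u < v) || (u == v) && (x < y).
  move: hn hx hy; move: (nat_of_ord x) (nat_of_ord y) n.-1 => x' y' n' -> hx hy.
  by have [lt|lt|->] := ltngtP u v; nia.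
have hb := ltn_ord b; have hc := ltn_ord c; rewrite hlex.
have nxy' : (x : nat) != y by apply: contra nxy => /eqP/val_inj ->.
have -> : (c == b) = ((c : nat) == b) by [].
have [lt|lt|->] := ltngtP p q.
- have h : r * p.+1 <= r * q by rewrite leq_mul2l lt orbT.
  have lt' : r * p + b < r * q + c by rewrite mulnS in h; lia.
  rewrite [RHS]leqNgt (ltn_addr _ lt) ltnNge (ltnW lt') /=.
  by rewrite gtn_eqF.
- have h : r * q.+1 <= r * p by rewrite leq_mul2l lt orbT.
  have -> : r * q + c < r * p + b by rewrite mulnS in h; lia.
  by rewrite /=; case: (_ || _); rewrite ?addn1 ?addn0 ?lt ?(ltnW lt).
by rewrite ltn_add2l eqn_add2l; move: nxy'; case: (ltngtP x y); case: (ltngtP c b) => //=; lia.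
Qed.

Lemma mem_DesE g i j : j = i.+1 :> nat ->
  (i \in Des g) = letter_lt (letter g j) (letter g i).
Proof.
move=> e; rewrite inE; apply/existsP/idP => [[j' /andP[/eqP e']]|h].
  by have -> : j' = j by apply: val_inj; rewrite /= e' e.
by exists j; rewrite e eqxx.
Qed.

Lemma Des_ltn g i : i \in Des g -> i.+1 < n.
Proof. by rewrite inE => /existsP[j /andP[/eqP <-]]. Qed.

Lemma d_step g i j : j = i.+1 :> nat -> d_ g i = d_ g j + (i \in Des g).
Proof.
move=> e; rewrite /d_ (cardsD1 i) inE leqnn andbT addnC; congr (_ + _).
apply: eq_card => u; rewrite !inE e /= andbCA; congr (_ && _).
by rewrite ltn_neqAle eq_sym.
Qed.

Lemma d_last g i : i.+1 = n -> d_ g i = 0.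
Proof.
move=> e; apply: eq_card0 => u; rewrite !inE; apply/negP => /andP[h].
by have := @Des_ltn g u; rewrite inE => /(_ h); lia.
Qed.

Lemma d_first g i : i = 0 :> nat -> d_ g i = des g.
Proof. by move=> e; apply: eq_card => u; rewrite !inE e leq0n andbT. Qed.

End Descents.

(** * Standard form of a monomial *)

Section Standardization.
Variables r n k : nat.
Implicit Types (g : colored_perm r n) (m : 'X_{1..n}) (e : seq nat).

Definition descent_exponent g e : 'X_{1..n} :=
  [multinom r * (d_ g ((g.1)^-1%g x) + nth 0 e ((g.1)^-1%g x))
            + g.2 ((g.1)^-1%g x) | x < n].

(** The sequence has [n - k] entries; by the default value of [nth], the exponents
above receive nothing from it at the later positions. *)
Definition descent_data g e :=
  [&& des g < k, size e == n - k, sorted geq e & all (fun x => x < k - des g) e].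

Lemma key_le (a : 'I_n -> nat) x y : key a y <= key a x -> a y <= a x.
Proof.
rewrite /key => h; have := ltn_ord x; have := ltn_ord y.
by have [//|lt] := leqP (a y) (a x); nia.
Qed.

(** The trichotomy behind straightening.  In the last case [A] consists of the
letters up to the last position where the quotient exceeds the number of descents
from there on; the quotient drops so much after that position that [A] still precedes
its complement once the exponents on [A] are lowered by [r]. *)
Lemma straighten_cases m : 0 < r -> 0 < n -> k <= n ->
  [\/ exists x, k * r <= m x,
      exists g e, descent_data g e /\ m = descent_exponent g e |
      exists A : {set 'I_n},
        [/\ exists2 j, j < k & #|A| = n - j,
            forall x, x \in A -> r <= m x &
            forall x y, x \in A -> y \notin A -> key m y + r * n < key m x]].
Proof.
move=> r0 n0 kn; have [s hs] := sorts_exists m.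
pose g : colored_perm r n := (s, [ffun i => Ordinal (ltn_pmod (m (s i)) r0)]).
pose q i := m (s i) %/ r.
have mE i : m (s i) = r * q i + m (s i) %% r by rewrite mulnC -divn_eq.
(* With a free quotient [p], so that it applies also after [p] is decreased. *)
have step (i j : 'I_n) (e : j = i.+1 :> nat) p :
    (key m (s j) < (r * p + m (s i) %% r) * n + (n.-1 - s i))
    = (q j + (i \in Des g) <= p).
  have nij : s i != s j.
    by apply/eqP => /perm_inj eij; move: e; rewrite eij; lia.
  rewrite (mem_DesE g e) /letter /= !ffunE -key_step //=.
  by rewrite /key {1}mE.
have qstep (i j : 'I_n) (e : j = i.+1 :> nat) : q j + (i \in Des g) <= q i.
  by rewrite -step // -mE; apply: hs; rewrite e.
have dq i : d_ g i <= q i.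
  have [t] := ubnP (n - i); elim: t i => // t IH i; rewrite ltnS => ht.
  have [e|ne] := eqVneq i.+1 n; first by rewrite (d_last g e).
  have lt : i.+1 < n by rewrite ltn_neqAle ne ltn_ord.
  rewrite (@d_step _ _ g i (Ordinal lt)) //.
  apply: leq_trans (qstep i (Ordinal lt) _) => //.
  by rewrite leq_add2r; apply: IH => /=; lia.
have gapstep (i j : 'I_n) : j = i.+1 :> nat -> q j - d_ g j <= q i - d_ g i.
  by move=> e; rewrite (d_step g e); have := qstep _ _ e; lia.
have gap (i j : 'I_n) : i <= j -> q j - d_ g j <= q i - d_ g i.
  rewrite leq_eqVlt => /orP[/eqP/val_inj -> //|].
  apply: (@ord_homo n (fun x y => y <= x) (fun i => q i - d_ g i)) => //.
  by move=> x y z h1 h2; apply: leq_trans h2 h1.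
have [/existsP[x hx]|big] := boolP [exists x, k * r <= m x]; first by constructor 1; exists x.
have [/existsP[i1 hi1]|nogap] := boolP [exists i : 'I_n, (n - k <= i) && (d_ g i < q i)].
  constructor 3.
  (* The last position at which the gap is positive. *)
  have [i0 /andP[hk hd] hmax] :=
    @arg_maxnP _ i1 (fun i : 'I_n => (n - k <= i) && (d_ g i < q i)) (@nat_of_ord n) hi1.
  pose I := [set i : 'I_n | i <= i0].
  have le0 (i : 'I_n) : i <= i0 -> key m (s i0) <= key m (s i).
    rewrite leq_eqVlt => /orP[/eqP/val_inj -> //|/hs]; exact: ltnW.
  exists (s @: I); split.
  - exists (n - i0.+1); first by have := ltn_ord i0; lia.
    rewrite card_imset; last exact: perm_inj.
    rewrite (subKn (ltn_ord i0)) -[RHS](card_ord i0.+1).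
    have -> : I = [set widen_ord (ltn_ord i0) j | j : 'I_i0.+1].
      apply/setP => i; rewrite inE; apply/idP/imsetP => [h|[j _ ->]]; last exact: (ltn_ord j).
      by exists (Ordinal (h : i < i0.+1)) => //; apply: val_inj.
    by rewrite card_imset // => j1 j2 /(congr1 val) /= ?; apply: val_inj.
  - move=> _ /imsetP[i hi ->]; rewrite inE in hi.
    apply: leq_trans (key_le (le0 _ hi)); rewrite mE.
    by have : 0 < q i0 by [lia]; move: (q i0); nia.
  - move=> _ y /imsetP[i hi ->] hy; rewrite inE in hi.
    have hj : i0 < s^-1%g y.
      rewrite ltnNge; apply: contra hy => h; apply/imsetP.
      by exists (s^-1%g y); rewrite ?inE ?permKV.
    have lt : i0.+1 < n by apply: leq_ltn_trans hj _.
    have ly : key m y <= key m (s (Ordinal lt)).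
      rewrite -[y](permKV s).
      move: hj; rewrite leq_eqVlt => /orP[/eqP e|/(hs (Ordinal lt))/ltnW //].
      by have -> : s^-1%g y = Ordinal lt by apply: val_inj.
    have qd : q (Ordinal lt) = d_ g (Ordinal lt).
      apply/eqP; rewrite eqn_leq dq andbT leqNgt; apply/negP => h.
      by have := hmax (Ordinal lt); rewrite h andbT /=; lia.
    have := @step i0 (Ordinal lt) erefl (q i0).-1.
    rewrite qd -(@d_step _ _ g i0 (Ordinal lt)) //.
    have -> : d_ g i0 <= (q i0).-1 by lia.
    move=> lts; have : key m (s i0) = (r * (q i0).-1 + m (s i0) %% r) * n + (n.-1 - s i0) + r * n.
      rewrite /key {1}mE -{1}[q i0]prednK; last by lia.
      by rewrite mulnS; nia.
    by have := le0 _ hi; lia.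
pose gaps := mkseq (fun i => q (insubd (Ordinal n0) i) - d_ g (insubd (Ordinal n0) i)) (n - k).
constructor 2; exists g, gaps.
have nth_q (i : 'I_n) : d_ g i + nth 0 gaps i = q i.
  have [lt|le] := ltnP i (n - k).
    rewrite nth_mkseq //; have -> : insubd (Ordinal n0) (val i) = i by rewrite valKd.
    by rewrite subnKC.
  rewrite nth_default ?size_mkseq // addn0; apply/eqP; rewrite eqn_leq dq leqNgt.
  by apply: contra nogap => h; apply/existsP; exists i; rewrite le h.
have q0 (i : 'I_n) : q i < k.
  rewrite ltn_divLR // ltnNge; apply: contra big => h; apply/existsP; by exists (s i).
have hdes : des g <= q (Ordinal n0) by rewrite -(@d_first _ _ g (Ordinal n0)).
split; last first.
  by apply/mnmP => x; rewrite mnmE nth_q /= ffunE /= -mE permKV.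
apply/and4P; split.
- by apply: leq_ltn_trans hdes _.
- by rewrite size_mkseq.
- apply: (homo_sorted_in (e := ltn) (P := fun i => i < n - k)); last exact: iota_ltn_sorted.
    move=> i j hi hj ij /=; apply: gap.
    by rewrite !val_insubd; move: hi hj ij; rewrite !unfold_in /=; case: ifP; case: ifP; lia.
  by apply/allP => i; rewrite mem_iota.
- apply/allP => _ /mapP[i hi ->].
  have := gap (Ordinal n0) (insubd (Ordinal n0) i) (leq0n _).
  rewrite (@d_first _ _ g (Ordinal n0)) //.
  by have := q0 (Ordinal n0); lia.
Qed.

End Standardization.

(** * Induction on the potential *)

Section Induction.
Variables r n k : nat.
Implicit Types (m : 'X_{1..n}).

Definition raise m (A : {set 'I_n}) : 'X_{1..n} := (m + mesym1 A *+ r)%MM.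

Lemma raiseE m A x : raise m A x = m x + r * (x \in A).
Proof. by rewrite mnmDE mulmnE mnmE mulnC. Qed.

Lemma mdeg_raise m A : mdeg (raise m A) = mdeg m + #|A| * r.
Proof. by rewrite mdegD mdegMn mdeg_mesym1. Qed.

(** Raising the exponents on [A] by [r] changes this number by [2 * r] times the
sum of the keys on [A], plus a constant that depends on the size of [A] only; so
among the sets of a given size the one with the largest keys gives the largest
potential. *)
Definition potential m := \sum_x (n * m x ^ 2 + (2 * (n.-1 - x)) * m x).

Lemma potential_raise m A :
  potential (raise m A)
  = potential m + \sum_(x in A) (2 * r * key m x + n * r ^ 2).
Proof.
rewrite /potential [X in _ = _ + X]big_mkcond -big_split /=; apply: eq_bigr => x _.
by rewrite raiseE /key; case: (x \in A); nia.
Qed.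

(** The last premise is the shape of the relation given by an elementary symmetric
polynomial: the monomial is expressed by the other terms, to which the induction
hypothesis applies since they have a smaller potential. *)
Lemma straighten_ind (P : 'X_{1..n} -> Prop) : 0 < r -> 0 < n -> k <= n ->
    (forall m x, k * r <= m x -> P m) ->
    (forall g e, descent_data (r := r) k g e -> P (descent_exponent g e)) ->
    (forall m (A : {set 'I_n}) j, j < k -> #|A| = n - j ->
       (forall B : {set 'I_n}, #|B| = n - j -> B != A -> P (raise m B)) -> P (raise m A)) ->
  forall m, P m.
Proof.
move=> r0 n0 kn Pbig PD Pstep m.
have [t] := ubnP (potential m); elim: t m => // t IH m; rewrite ltnS => ht.
have [[x]|[g [e [hge ->]]]|[A [[j jk cA] rA hA]]] := straighten_cases m r0 n0 kn.
- exact: Pbig.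
- exact: PD.
pose m0 := (m - mesym1 A *+ r)%MM.
have m0E x : m0 x = m x - r * (x \in A) by rewrite mnmBE mulmnE mnmE mulnC.
have em : m = raise m0 A.
  apply/mnmP => x; rewrite raiseE m0E.
  by case: (boolP (x \in A)) => [/rA|_]; rewrite ?muln1 ?muln0; lia.
rewrite em; apply: (Pstep _ _ j) => // B cB nBA; apply: IH; apply: leq_trans ht.
rewrite [in X in _ < X]em !potential_raise ltn_add2l; apply: sum_top_set => //.
  by rewrite cB.
move=> x y xA yA; rewrite ltn_add2r ltn_pmul2l ?muln_gt0 //.
have := hA x y xA yA; rewrite /key !m0E xA (negbTE yA) muln1 muln0 subn0.
by have := rA x xA; rewrite mulnBl; have := leq_mul2r n r (m x); nia.
Qed.

End Induction.

(** * Counting descent monomials *)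

Section Counting.
Variables r n k : nat.
Implicit Types (g : colored_perm r n) (B : {set 'I_n}).

Definition ascents g : {set 'I_n} := [set i : 'I_n | i.+1 < n] :\: Des g.

Lemma card_ltn_pred : #|[set i : 'I_n | i.+1 < n]| = n.-1.
Proof.
case: n => [|n']; first by apply: eq_card0 => -[].
have -> : [set i : 'I_n'.+1 | i.+1 < n'.+1] = [set~ ord_max].
  apply/setP => i; rewrite !inE -val_eqE /=; have := ltn_ord i.
  by rewrite !ltnS; case: ltngtP.
by rewrite cardsC1 card_ord.
Qed.

Lemma card_ascents g : #|ascents g| = n.-1 - des g.
Proof.
rewrite cardsD card_ltn_pred (setIidPr _) //.
by apply/subsetP => i /Des_ltn; rewrite inE.
Qed.

(** A set of gaps of the listing, all ascents, to be left without a bar; the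
[k - 1] other gaps separate [k] blocks. *)
Definition merges g B := [&& des g < k, B \subset ascents g & #|B| == n - k].

(** Both sides count to ['C(n - 1 - des g, n - k)]: weakly decreasing sequences of
[n - k] entries below [k - des g], and subsets of the [n - 1 - des g] ascents. *)
Lemma card_descent_data_fiber g : k <= n ->
  #|[set t : (n - k).-tuple 'I_k | descent_data k g (map val t)]|
    <= #|[set B | merges g B]|.
Proof.
move=> kn; have [hd|hd] := ltnP (des g) k; last first.
  by rewrite eq_card0 // => t; rewrite !inE /descent_data ltnNge hd.
have -> : [set B | merges g B] = [set B : {set 'I_n} | B \subset ascents g & #|B| == n - k].
  by apply/setP => B; rewrite !inE /merges hd.
rewrite cards_draws card_ascents.
have -> : n.-1 - des g = n - k + (k - des g).-1 by lia.
rewrite -card_sorted_tuples.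
pose f (t : (n - k).-tuple 'I_k) : (n - k).-tuple 'I_(k - des g).-1.+1 :=
  rev_tuple (map_tuple (fun i : 'I_k => inord i) t).
have fE (t : (n - k).-tuple 'I_k) :
    all (fun x => x < k - des g) (map val t) -> map val (f t) = rev (map val t).
  move=> ht; rewrite /f /= map_rev -map_comp; congr rev; apply/eq_in_map => i hi /=.
  by rewrite inordK // prednK ?subn_gt0 //; apply: (allP ht); apply: map_f.
rewrite -(card_in_imset (f := f)).
  apply: subset_leq_card; apply/subsetP => u /imsetP[t]; rewrite inE => /and4P[_ _ st ht] ->{u}.
  by rewrite inE fE // rev_sorted.
move=> t u; rewrite !inE => /and4P[_ _ _ ht] /and4P[_ _ _ hu] /(congr1 (fun v => map val (val v))).
rewrite !fE // => /(can_inj revK)/(inj_map val_inj) e; exact: val_inj.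
Qed.

Definition colored_surjections : {set {ffun 'I_n -> 'I_k * 'I_r}} :=
  [set y : {ffun 'I_n -> 'I_k * 'I_r} | [forall j, exists x, (y x).1 == j]].

Lemma card_sum_fiber (T U : finType) (P : T -> U -> bool) :
  #|[set p : T * U | P p.1 p.2]| = \sum_(t : T) #|[set u | P t u]|.
Proof.
rewrite -sum1_card (eq_bigl (fun p => predT p.1 && P p.1 p.2)); last by move=> p; rewrite inE.
rewrite -(pair_big_dep predT P (fun _ _ => 1)) /=; apply: eq_bigr => t _.
by rewrite sum1dep_card.
Qed.

Definition bars B (i : 'I_n) := #|[set h : 'I_n | (h < i) && (h \notin B)]|.

Lemma bars_step B (i j : 'I_n) : j = i.+1 :> nat -> bars B j = bars B i + (i \notin B).
Proof.
move=> e; rewrite /bars (cardsD1 i) inE e ltnSn /= addnC; congr (_ + _).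
apply: eq_card => h; rewrite !inE ltnS -val_eqE /= andbA; congr (_ && _).
by rewrite [RHS]ltn_neqAle.
Qed.

Section Merge.
Variables (g : colored_perm r n) (B : {set 'I_n}).
Hypotheses (n0 : 0 < n) (kn : k <= n) (gB : merges g B).

Let k0 : 0 < k. Proof. by case/and3P: gB; case: k. Qed.

Lemma merges_ltn i : i \in B -> i.+1 < n.
Proof. by case/and3P: gB => _ /subsetP h _ /h; rewrite !inE => /andP[]. Qed.

Lemma merges_asc i : i \in B -> i \notin Des g.
Proof. by case/and3P: gB => _ /subsetP h _ /h; rewrite /ascents in_setD => /andP[]. Qed.

Lemma bars_total : #|[set i : 'I_n | i.+1 < n] :\: B| = k.-1.
Proof.
case/and3P: (gB) => _ _ /eqP cB.
rewrite cardsD card_ltn_pred (setIidPr _) ?cB; first by lia.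
by apply/subsetP => i /merges_ltn; rewrite inE.
Qed.

Lemma bars_lt i : bars B i < k.
Proof.
rewrite -(prednK k0) ltnS -bars_total; apply: subset_leq_card.
apply/subsetP => h; rewrite !inE => /andP[lt ->] /=.
by apply: leq_ltn_trans lt (ltn_ord i).
Qed.

Lemma bars_last (i : 'I_n) : i.+1 = n -> bars B i = k.-1.
Proof.
move=> e; rewrite -bars_total; apply: eq_card => h; rewrite !inE andbC; congr (_ && _).
by apply/idP/idP; lia.
Qed.

Definition merge : {ffun 'I_n -> 'I_k * 'I_r} :=
  [ffun x => (Ordinal (bars_lt (g.1^-1%g x)), g.2 (g.1^-1%g x))].

(** The number of bars starts at [0], ends at [k - 1] and grows by at most one, so
each block is met; the last position with at most [j] bars before it is in
block [j]. *)
Lemma merge_surj : merge \in colored_surjections.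
Proof.
rewrite inE; apply/forallP => j; pose i0 := Ordinal n0.
have hi0 : bars B i0 <= j by rewrite /bars eq_card0 // => h; rewrite !inE.
have [i hi hmax] := @arg_maxnP _ i0 (fun i => bars B i <= j) (@nat_of_ord n) hi0.
apply/existsP; exists (g.1 i); rewrite ffunE permK -val_eqE /= eqn_leq hi /=.
have [e|ne] := eqVneq i.+1 n.
  by rewrite bars_last // -ltnS prednK.
have lt : i.+1 < n by rewrite ltn_neqAle ne ltn_ord.
rewrite leqNgt; apply/negP => h.
have := hmax (Ordinal lt); rewrite (@bars_step B i) //= ltnn => H.
by have : bars B i + (i \notin B) <= j by [case: (_ \notin _); lia]; move/H.
Qed.

(** The underlying permutation lists the letters as if they had exponents that
decrease with the block and, inside a block, grow with the color; this makes it
readable from the point. *)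
Lemma merge_sorts :
  sorts (fun x => r * (k.-1 - (merge x).1) + (merge x).2) g.1.
Proof.
have := @ord_homo n (fun u v => v < u)
  (fun i => key (fun x => r * (k.-1 - (merge x).1) + (merge x).2) (g.1 i)).
apply; first by move=> u v w h1 h2; apply: ltn_trans h2 h1.
move=> i j e; have nij : g.1 i != g.1 j.
  by apply/eqP => /perm_inj eij; move: e; rewrite eij; lia.
rewrite /key !ffunE !permK /= key_step //.
have := mem_DesE g e; rewrite /letter /perm_of /color_of => <-.
have := bars_lt j; rewrite (bars_step B e).
by case: (boolP (i \in B)) => [/merges_asc/negbTE -> /=|_]; last case: (i \in Des g); lia.
Qed.

End Merge.

Lemma merge_inj g g' B B' (gB : merges g B) (gB' : merges g' B') (n0 : 0 < n) (kn : k <= n) :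
  merge n0 kn gB = merge n0 kn gB' -> (g, B) = (g', B').
Proof.
move=> e; have e1 : g.1 = g'.1.
  apply: sorts_uniq (merge_sorts n0 kn gB) _; rewrite e; exact: merge_sorts.
have e2 : g.2 = g'.2.
  apply/ffunP => i; have := congr1 (fun f : {ffun 'I_n -> 'I_k * 'I_r} => (f (g.1 i)).2) e.
  by rewrite !ffunE e1 permK.
have eb i : bars B i = bars B' i.
  have := congr1 (fun f : {ffun 'I_n -> 'I_k * 'I_r} => val (f (g.1 i)).1) e.
  by rewrite !ffunE e1 /= permK.
congr (_, _); first by case: (g) (g') e1 e2 => ? ? [? ?] /= -> ->.
apply/setP => i; have [lt|ge] := ltnP i.+1 n; last first.
  by apply/idP/idP => [/(merges_ltn gB)|/(merges_ltn gB')]; lia.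
have := eb (Ordinal lt); rewrite (@bars_step B i) // (@bars_step B' i) // eb => /addnI.
by case: (i \in B); case: (i \in B').
Qed.

Lemma card_descent_data : 0 < n -> k <= n ->
  #|[set p : colored_perm r n * (n - k).-tuple 'I_k | descent_data k p.1 (map val p.2)]|
    <= #|colored_surjections|.
Proof.
move=> n0 kn.
rewrite (card_sum_fiber (fun g (t : (n - k).-tuple 'I_k) => descent_data k g (map val t))).
apply: (@leq_trans (\sum_(g : colored_perm r n) #|[set B | merges g B]|)).
  by apply: leq_sum => g _; apply: card_descent_data_fiber.
pose M := [set p : colored_perm r n * _ | merges p.1 p.2].
rewrite -card_sum_fiber -(card_sig (fun p => p \in M)).
have h (p : {p | p \in M}) : merges (val p).1 (val p).2.
  by have := valP p; rewrite inE.
rewrite -(card_imset (f := fun p => merge n0 kn (h p))) //.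
  by apply: subset_leq_card; apply/subsetP => _ /imsetP[p _ ->]; apply: merge_surj.
move=> p p' /merge_inj e; apply: val_inj.
by move: e; case: (val p) (val p') => ? ? [].
Qed.

(** Different data may give the same monomial for all that is known at this stage,
so duplicates are removed; that there are none follows from the final count. *)
Definition descent_exponents : seq 'X_{1..n} :=
  undup [seq descent_exponent u.1 (map val u.2)
        | u : colored_perm r n * (n - k).-tuple 'I_k
        <- enum [set u : colored_perm r n * (n - k).-tuple 'I_k
                | descent_data k u.1 (map val u.2)]].

Lemma mem_descent_exponents m :
  m \in descent_exponents <->
  exists g e, descent_data (r := r) k g e /\ m = descent_exponent g e.
Proof.
rewrite mem_undup; split=> [/mapP[p]|[g [e [hge ->]]]].
  by rewrite mem_enum inE => h ->; exists p.1, (map val p.2).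
have /and4P[_ /eqP se _ /allP he] := hge.
have {}he x : x \in e -> (x < k)%N by move/he/leq_trans; apply; apply: leq_subr.
have [t et] : exists t : (n - k).-tuple 'I_k, map val t = e.
  have st : size (pmap (insub : nat -> option 'I_k) e) == (n - k)%N.
    by rewrite -se size_pmap_sub -all_count; apply/allP.
  exists (Tuple st); rewrite /= (pmap_filter (insubK _)); apply/all_filterP/allP => x /he hx.
  by rewrite /= isSome_insub.
by apply/mapP; exists (g, t); rewrite ?mem_enum ?inE /= et.
Qed.

Lemma size_descent_exponents : (0 < n)%N -> (k <= n)%N ->
  size descent_exponents <= #|colored_surjections|.
Proof.
move=> n0 kn; apply: leq_trans (size_undup _) _.
by rewrite size_map -cardE; apply: card_descent_data.
Qed.

End Counting.

(** * Straightening modulo the ideal *)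

Section Ideal.
Import GRing.Theory.
Local Open Scope ring_scope.
Variables (K : fieldType) (r n k : nat).
Implicit Types (p q : {mpoly K[n]}) (m : 'X_{1..n}).

(** The generators, indexed by their degree. *)
Variant J_generator : nat -> {mpoly K[n]} -> Prop :=
| PowerGenerator i : J_generator (k * r) ('X_i ^+ (k * r))
| EsymGenerator j : (j < k)%N -> J_generator ((n - j) * r) (esym_pow K r n (n - j)).

Lemma esym_powE d :
  esym_pow K r n d = \sum_(A : {set 'I_n} | #|A| == d) 'X_[mesym1 A *+ r].
Proof.
rewrite /esym_pow mesymE raddf_sum /=; apply: eq_bigr => A _.
rewrite comp_mpolyX mpolyXE_id; apply: eq_bigr => i _.
by rewrite tnth_mktuple mulmnE mulnC exprM.
Qed.

Lemma mulX_esym_pow m d :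
  'X_[m] * esym_pow K r n d = \sum_(A : {set 'I_n} | #|A| == d) 'X_[raise r m A].
Proof. by rewrite esym_powE mulr_sumr; apply: eq_bigr => A _; rewrite mpolyXD. Qed.

Lemma J_generator_homog D p : J_generator D p -> p \is D.-homog.
Proof.
case=> [i|j _].
  by rewrite mpolyXn dhomogX /= mdegMn mdeg1 mul1n.
rewrite esym_powE; apply: rpred_sum => A /eqP cA.
by rewrite dhomogX /= mdegMn mdeg_mesym1 cA.
Qed.

Lemma J_generatorP p :
  p \in J_gens K r n k -> exists D, J_generator D p.
Proof.
rewrite mem_cat => /orP[/mapP[i _ ->]|/mapP[j]].
  by exists (k * r)%N; constructor.
by rewrite mem_iota add0n => /andP[_ jk] ->; exists ((n - j) * r)%N; constructor.
Qed.

Lemma J_generator_mem D p : J_generator D p -> p \in J_gens K r n k.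
Proof.
rewrite mem_cat => -[i|j jk]; apply/orP; [left|right]; apply/mapP.
  by exists i; rewrite ?mem_enum.
by exists j; rewrite ?mem_iota.
Qed.

Lemma mem_ideal_gen (s : seq {mpoly K[n]}) p : p \in s -> p \in ideal_gen s.
Proof.
move=> hp; have lt : (index p s < size s)%N by rewrite index_mem.
apply/ideal_genP; exists (fun i => (i == Ordinal lt)%:R).
rewrite (bigD1 (Ordinal lt)) //= eqxx mul1r nth_index // big1 ?addr0 // => i /negbTE ->.
by rewrite mul0r.
Qed.

(** A degreewise form that serves twice: for membership in the span modulo the
ideal, and for values on a finite set of points, where multiples of generators
are known to lie in the span only degree by degree. *)
Lemma straighten (Q : {mpoly K[n]} -> Prop) (d : nat) :
    (0 < r)%N -> (0 < n)%N -> (k <= n)%N ->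
    Q 0 -> (forall p q, Q p -> Q q -> Q (p - q)) ->
    (forall g e, descent_data (r := r) k g e -> mdeg (descent_exponent g e) = d ->
       Q 'X_[descent_exponent g e]) ->
    (forall m D p, J_generator D p -> (mdeg m + D)%N = d -> Q ('X_[m] * p)) ->
  forall m, mdeg m = d -> Q 'X_[m].
Proof.
move=> r0 n0 kn Q0 QB QD QJ m.
pose P m := mdeg m = d -> Q 'X_[m]; rewrite -/(P m); move: m.
have QA p q : Q p -> Q q -> Q (p + q).
  by move=> Qp Qq; rewrite -[q]opprK; apply: (QB) => //; rewrite -sub0r; apply: (QB).
apply: (straighten_ind (r := r) r0 n0 kn) => [m x hx|g e|m A j jk cA IH] dm.
- (* A monomial with a large exponent is a multiple of a power generator. *)
  have em : m = (m - U_(x) *+ (k * r) + U_(x) *+ (k * r))%MM.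
    apply/mnmP => y; rewrite mnmDE mnmBE mulmnE mnm1E.
    by case: eqP => [<-|_]; rewrite ?mul1n ?mul0n ?subn0 ?addn0 // subnK.
  rewrite em mpolyXD -mpolyXn; apply: (QJ _ (k * r)%N); first by constructor.
  by rewrite -dm {2}em mdegD [mdeg (U_(x) *+ _)]mdegMn mdeg1 mul1n.
- exact: QD.
have dj : (mdeg m + (n - j) * r)%N = d by rewrite -dm mdeg_raise cA.
have := QJ m _ _ (EsymGenerator jk) dj.
rewrite mulX_esym_pow (bigD1 A) ?cA //=.
set s := \sum_(_ | _) _ => h.
have -> : 'X_[raise r m A] = ('X_[raise r m A] + s) - s by rewrite addrK.
apply: QB => //; rewrite /s; apply: (big_ind Q) => // B /andP[/eqP cB nBA].
by apply: IH => //; rewrite mdeg_raise cB.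
Qed.

End Ideal.

(** * Evaluation at the points *)

Section Points.
Import GRing.Theory.
Local Open Scope ring_scope.
Variables (K : fieldType) (r n k : nat).
Variables (z : 'I_k * 'I_r -> K) (alpha : 'I_k -> K).
Hypothesis z_inj : injective z.
Hypothesis z_pow : forall u, z u ^+ r = alpha u.1.
Hypotheses (r0 : (0 < r)%N) (n0 : (0 < n)%N) (kn : (k <= n)%N).
Implicit Types (p q : {mpoly K[n]}) (m : 'X_{1..n}).

Local Notation Y := (colored_surjections r n k).
Local Notation N := #|Y|.

Definition point (i : 'I_N) (x : 'I_n) : K := z ((enum_val i : {ffun _ -> _}) x).

Definition ev p : 'rV[K]_N := \row_i p.@[point i].

Lemma ev_is_linear : linear ev.
Proof. by move=> a p q; apply/rowP => i; rewrite !mxE mevalD mevalZ. Qed.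

HB.instance Definition _ :=
  GRing.isLinear.Build K {mpoly K[n]} 'rV[K]_N *:%R ev ev_is_linear.

(** For [p] homogeneous of degree [e]: some polynomial with the same values as [p]
has degree less than [e], as [msize] is one more than the degree. *)
Definition lowered e p := exists2 p', (msize p' <= e)%N & ev p = ev p'.

Lemma msize_sum_le (I : Type) (s : seq I) (P : pred I) (F : I -> {mpoly K[n]}) e :
  (forall i, P i -> (msize (F i) <= e)%N) -> (msize (\sum_(i <- s | P i) F i) <= e)%N.
Proof.
move=> h; apply: (big_ind (fun p => (msize p <= e)%N)) => //; first by rewrite mmeasure0.
by move=> p q hp hq; apply: leq_trans (mmeasureD_le _ _ _) _; rewrite geq_max hp.
Qed.

Lemma meval_sum v (I : Type) (s : seq I) (P : pred I) (F : I -> {mpoly K[n]}) :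
  (\sum_(i <- s | P i) F i).@[v] = \sum_(i <- s | P i) (F i).@[v].
Proof. exact: (raddf_sum (meval v)). Qed.

Lemma lowered_mulX m e p : lowered e p -> lowered (mdeg m + e) ('X_[m] * p).
Proof.
move=> [p' hp' ep]; exists ('X_[m] * p').
  have [->|nz] := eqVneq p' 0; first by rewrite mulr0 mmeasure0.
  rewrite msizeM //; last by rewrite -msize_poly_eq0 msizeX.
  by rewrite msizeX addSn /= leq_add2l.
apply/rowP => i; rewrite !mxE !mevalM; congr (_ * _).
by have := congr1 (fun v : 'rV__ => v 0 i) ep; rewrite !mxE.
Qed.

Let alpha_poly : {poly K} := \prod_(j < k) ('X - (alpha j)%:P).

Let alpha_poly_monic : alpha_poly \is monic. Proof. exact: monic_prod_XsubC. Qed.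

Let size_alpha_poly : size alpha_poly = k.+1.
Proof. by rewrite size_prod_XsubC /index_enum -enumT size_enum_ord. Qed.

(** On the points, [x_i ^ r] is one of the [alpha j], hence a root of a monic
polynomial of degree [k]. *)
Lemma lowered_power i : lowered (k * r) ('X_i ^+ (k * r)).
Proof.
exists (- \sum_(l < k) alpha_poly`_l *: 'X_i ^+ (l * r)).
  rewrite mmeasureN; apply: msize_sum_le => l _.
  apply: leq_trans (msizeZ_le _ _) _; rewrite mpolyXn msizeX mdegMn mdeg1 mul1n.
  by rewrite ltn_pmul2r.
apply/rowP => y; rewrite !mxE mevalN meval_sum rmorphXn /= mevalXU.
set u := point y i.
have rootu : root alpha_poly (u ^+ r).
  apply/rootP; rewrite /alpha_poly horner_prod (bigD1 ((enum_val y : {ffun _ -> _}) i).1) //=.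
  by rewrite hornerXsubC /u /point z_pow subrr mul0r.
move: rootu; rewrite /root horner_coef size_alpha_poly big_ord_recr /=.
have -> : alpha_poly`_k = 1 by have := monicP alpha_poly_monic; rewrite lead_coefE size_alpha_poly.
rewrite mul1r addrC addr_eq0 => /eqP uk; rewrite mulnC exprM uk; congr (- _).
by apply: eq_bigr => l _; rewrite mevalZ rmorphXn /= mevalXU -exprM mulnC.
Qed.

(** Every [alpha j] occurs among the [x_i ^ r], so [prod_i (T - x_i ^ r)] is zero
modulo [prod_j (T - alpha j)].  Its coefficients are elementary symmetric
polynomials, and reducing the powers of [T] modulo the divisor turns the
coefficient of [T ^ j], for [j < k], into a combination of the coefficients of
[T ^ l] with [l >= k], which have smaller degree in the [x_i]. *)
Lemma lowered_esym j : (j < k)%N -> lowered ((n - j) * r) (esym_pow K r n (n - j)).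
Proof.
move=> jk; pose rho l := ('X^l %% alpha_poly)`_j.
pose c l : K := - ((-1) ^+ (n - j) * (rho l * (-1) ^+ (n - l))).
exists (\sum_(l < n.+1 | (k <= l)%N) c l *: esym_pow K r n (n - l)).
  apply: msize_sum_le => l kl; apply: leq_trans (msizeZ_le _ _) _.
  rewrite esym_powE; apply: msize_sum_le => B /eqP cB.
  rewrite msizeX mdegMn mdeg_mesym1 cB ltn_pmul2r //.
  by have := ltn_ord l; lia.
apply/rowP => y; rewrite !mxE [RHS]meval_sum.
pose u := [tuple point y x ^+ r | x < n].
have esymE d : (esym_pow K r n d).@[point y] = (mesym n K d).@[tnth u].
  rewrite /esym_pow comp_mpoly_meval; apply: meval_eq => x.
  by rewrite !tnth_mktuple rmorphXn /= mevalXU.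
pose P := \prod_(v <- u) ('X - v%:P).
have sizeP : size P = n.+1 by rewrite size_prod_XsubC size_tuple.
have PE l : (l <= n)%N -> (mesym n K (n - l)).@[tnth u] = (-1) ^+ (n - l) * P`_l.
  move=> ln; have lt : (n - l < n.+1)%N by rewrite ltnS leq_subr.
  by rewrite -[in P`__](subKn ln) (mroots_coeff u (Ordinal lt)) /= signrMK.
(* The factors of the divisor are those of one chosen letter in each block. *)
have AP : alpha_poly %| P.
  have /forallP surj : [forall j, exists x, (enum_val y x).1 == j].
    by have := enum_valP y; rewrite inE.
  pose f j := xchoose (existsP (surj j)).
  have fE j' : (enum_val y (f j')).1 = j' by apply/eqP/(xchooseP (existsP (surj j'))).
  have f_inj : injective f by move=> j1 j2 e; rewrite -(fE j1) e fE.
  rewrite /P big_tuple (bigID (mem (codom f))) /=.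
  apply: dvdp_mulr; rewrite -big_filter (perm_big (codom f)) /=; last first.
    apply: uniq_perm; first exact/filter_uniq/index_enum_uniq.
      by rewrite map_inj_uniq ?enum_uniq.
    by move=> x; rewrite mem_filter mem_index_enum andbT.
  rewrite big_map big_enum /= /alpha_poly.
  rewrite (eq_bigr (fun j => 'X - (tnth u (f j))%:P)) ?dvdpp // => j' _.
  by rewrite tnth_mktuple /point z_pow fE.
have : (P %% alpha_poly)`_j = 0 by move/modp_eq0P: AP => ->; rewrite coef0.
have -> : (P %% alpha_poly)`_j = \sum_(l < n.+1) P`_l * rho l.
  rewrite -{1}[P]coefK poly_def sizeP.
  have -> (F : 'I_n.+1 -> {poly K}) : (\sum_l F l) %% alpha_poly = \sum_l (F l %% alpha_poly).
    by apply: (big_morph (fun t : {poly K} => t %% alpha_poly)); [exact: modpD|rewrite mod0p].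
  by rewrite coef_sum; apply: eq_bigr => l _; rewrite modpZl coefZ.
have jn : (j < n.+1)%N by lia.
rewrite (bigID (fun l : 'I_n.+1 => (k <= l)%N)) /= [X in _ + X](bigD1 (Ordinal jn)) /=; last first.
  by rewrite -ltnNge.
rewrite [X in _ + (_ + X)]big1 => [|l /andP[kl nlj]]; last first.
  rewrite /rho modp_small; last by rewrite size_polyXn size_alpha_poly ltnS ltnNge.
  by rewrite coefXn eq_sym -val_eqE /= in nlj *; rewrite (negbTE nlj) mulr0.
rewrite addr0 {2}/rho modp_small; last by rewrite size_polyXn size_alpha_poly ltnS.
rewrite coefXn eqxx mulr1 addrC => /eqP; rewrite addr_eq0 => /eqP Pj.
rewrite esymE PE; last by lia.
rewrite Pj mulrN -mulNr mulr_sumr; apply: eq_bigr => l kl.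
rewrite mevalZ esymE PE; last by rewrite -ltnS.
rewrite /c !mulNr; congr (- _).
by rewrite -!mulrA signrMK [rho l * _]mulrC.
Qed.

Lemma lowered_J_generator D p : J_generator r k D p -> lowered D p.
Proof. by case=> [i|j]; [apply: lowered_power|apply: lowered_esym]. Qed.


Definition descent_span e : {vspace 'rV[K]_N} :=
  <<[seq ev 'X_[m] | m <- [seq m <- descent_exponents r n k | (mdeg m < e)%N]]>>%VS.

Lemma descent_spanS e e' : (e <= e')%N -> (descent_span e <= descent_span e')%VS.
Proof.
move=> le; apply: sub_span => v /mapP[m]; rewrite mem_filter => /andP[lt hm] ->.
by apply: map_f; rewrite mem_filter hm (leq_trans lt).
Qed.

(** By induction on the degree: straightening is exact up to multiples of
generators, which have the values of polynomials of smaller degree. *)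
Lemma ev_descent_span e p : (msize p <= e)%N -> ev p \in descent_span e.
Proof.
elim: e p => [|e IH] p.
  by rewrite leqn0 msize_poly_eq0 => /eqP ->; rewrite linear0 mem0v.
move=> hp; rewrite [p]mpolyE linear_sum big_seq; apply: memv_suml => m /msize_mdeg_lt hm.
rewrite linearZ memvZ //; have {hm hp} := leq_trans hm hp.
rewrite ltnS leq_eqVlt => /orP[/eqP em|lt]; last first.
  by apply: (subvP (descent_spanS (leqnSn e))); apply: IH; rewrite msizeX.
pose Q p := ev p \in descent_span e.+1.
apply: (@straighten K r n k Q e) => //; rewrite /Q.
- by rewrite linear0 mem0v.
- by move=> p1 p2 h1 h2; rewrite linearB; apply: memvB.
- move=> g s hgs dm; apply: memv_span; apply: map_f.
  by rewrite mem_filter dm ltnSn; apply/mem_descent_exponents; exists g, s.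
- move=> m' D f /lowered_J_generator hp eD.
  have [p' hp' ->] := lowered_mulX m' hp.
  by apply: (subvP (descent_spanS (leqnSn e))); apply: IH; rewrite -eD.
Qed.

(** Lagrange interpolation, coordinate by coordinate; [z] is injective. *)
Lemma ev_delta i : exists p, ev p = delta_mx 0 i.
Proof.
pose y := (enum_val i : {ffun _ -> _}).
pose p := \prod_(x < n) \prod_(u | u != y x) ((z (y x) - z u)^-1 *: ('X_x - (z u)%:MP)).
have pE v : p.@[v] = \prod_(x < n) \prod_(u | u != y x) ((z (y x) - z u)^-1 * (v x - z u)).
  rewrite /p rmorph_prod; apply: eq_bigr => x _; rewrite rmorph_prod; apply: eq_bigr => u _.
  by rewrite /= mevalZ mevalB mevalXU mevalC.
exists p; apply/rowP => j; rewrite !mxE eqxx /= pE.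
have [->|ne] := eqVneq j i.
  rewrite big1 // => x _; rewrite big1 // => u nu.
  by rewrite mulVf // subr_eq0 (inj_eq z_inj) eq_sym.
have /forallPn[x nx] : ~~ [forall x, (enum_val j : {ffun _ -> _}) x == y x].
  apply: contra ne => /forallP h; apply/eqP/enum_val_inj/ffunP => x; exact/eqP.
rewrite (bigD1 x) //= (bigD1 ((enum_val j : {ffun _ -> _}) x)) //=.
by rewrite subrr mulr0 !mul0r.
Qed.

(** A spanning family with at most as many members as the dimension is free. *)
Lemma ev_descent_free : free [seq ev 'X_[m] | m <- descent_exponents r n k].
Proof.
apply: (@basis_free _ _ fullv); rewrite basisEdim; apply/andP; split.
  apply/subvP => v _; rewrite [v]row_sum_delta.
  apply: memv_suml => i _; rewrite memvZ //.
  have [p <-] := ev_delta i.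
  have := ev_descent_span (leqnn (msize p)); apply/subvP; apply: sub_span => w.
  by move=> /mapP[m]; rewrite mem_filter => /andP[_ hm] ->; apply: map_f.
by rewrite size_map dimvf /dim /= mul1n size_descent_exponents.
Qed.

Section DualFunctional.
Variable m0 : 'X_{1..n}.
Hypothesis hm0 : m0 \in descent_exponents r n k.

Let X := in_tuple [seq ev 'X_[m] | m <- descent_exponents r n k].

Let index_lt m : m \in descent_exponents r n k ->
  (index m (descent_exponents r n k) < size [seq ev 'X_[m] | m <- descent_exponents r n k])%N.
Proof. by rewrite size_map index_mem. Qed.

Local Notation i0 := (Ordinal (index_lt hm0)).

(** Taking the component of the degree of [m0] first is what makes this form vanish
on the ideal: the value of an element of the ideal need not be zero. *)
Definition dual p : K := coord X i0 (ev (pihomog mdeg (mdeg m0) p)).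

Lemma dual_is_linear : linear_for *%R dual.
Proof. by move=> a p q; rewrite /dual !linearP. Qed.

HB.instance Definition _ :=
  GRing.isLinear.Build K {mpoly K[n]} K *%R dual dual_is_linear.

Lemma coord_descent m : m \in descent_exponents r n k ->
  coord X i0 (ev 'X_[m]) = (m == m0)%:R.
Proof.
move=> hm; have -> : ev 'X_[m] = X`_(Ordinal (index_lt hm)).
  by rewrite /= (nth_map m) ?index_mem // nth_index.
rewrite coord_free; last exact: ev_descent_free.
by rewrite -val_eqE /= (inj_in_eq (@index_inj _ m0 (descent_exponents r n k))).
Qed.

Lemma dual_descent m : m \in descent_exponents r n k -> dual 'X_[m] = (m == m0)%:R.
Proof.
move=> hm; rewrite /dual pihomogX; case: eqP => [_|ne]; first exact: coord_descent.
by rewrite !linear0; case: eqP ne => // ->.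
Qed.

(** In the degree of [m0], a multiple of a generator takes values in the span of
descent monomials of smaller degree, which have no coordinate along [m0]. *)
Lemma dual_ideal p : p \in ideal_gen (J_gens K r n k) -> dual p = 0.
Proof.
move=> /ideal_genP[c ->]; rewrite linear_sum big1 // => i _.
have [D hD] := J_generatorP (mem_nth 0 (ltn_ord i)).
move: hD; set f := _`_i => hD; rewrite [c i]mpolyE mulr_suml linear_sum big1 // => m _.
rewrite -scalerAl linearZ /= (_ : dual _ = 0) ?mulr0 //.
have fhom : 'X_[m] * f \is (mdeg m + D).-homog.
  by apply: dhomogM; [rewrite dhomogX | exact: J_generator_homog hD].
rewrite /dual; have [eD|ne] := eqVneq (mdeg m + D)%N (mdeg m0); last first.
  by rewrite (pihomog_ne0 ne fhom) !linear0.
rewrite -eD pihomog_dE //.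
have [p' hp' ->] := lowered_mulX m (lowered_J_generator hD).
rewrite eD in hp'; have := ev_descent_span hp'.
have : (descent_span (mdeg m0) <= lker (linfun (coord X i0 : 'rV[K]_N -> K^o)))%VS.
  apply/span_subvP => v /mapP[m']; rewrite mem_filter => /andP[lt hm'] ->.
  rewrite memv_ker lfunE /= coord_descent //; case: (m' =P m0) lt => [->|//].
  by rewrite ltnn.
by move=> /subvP h /h; rewrite memv_ker lfunE => /eqP.
Qed.

End DualFunctional.

End Points.

(** * The basis of the quotient *)

Section Basis.
Import GRing.Theory Num.Theory.
Local Open Scope ring_scope.

Lemma mpolyX_descent_exponent (K : comNzRingType) r n k
    (g : colored_perm r n) (e : (n - k).-tuple nat) :
  'X_[descent_exponent g e] = descent_monomial g K *
    \prod_(j < n - k) 'X_(g.1 (widen_ord (leq_subr k n) j)) ^+ (r * tnth e j).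
Proof.
rewrite (mpolyXE K g.1) /descent_monomial /perm_of /color_of.
rewrite (eq_bigr (fun i : 'I_n => 'X_(g.1 i) ^+ (r * d_ g i + g.2 i)
                                * 'X_(g.1 i) ^+ (r * nth 0%N e i))); last first.
  by move=> i _; rewrite mnmE permK -exprD mulnDr addnAC.
rewrite big_split /=; congr (_ * _).
rewrite (bigID (fun i : 'I_n => (i < n - k)%N)) /= [X in _ * X]big1 ?mulr1; last first.
  by move=> i; rewrite -leqNgt => h; rewrite nth_default ?size_tuple // muln0.
rewrite (big_ord_narrow (leq_subr k n)); apply: eq_bigr => j _.
by rewrite (tnth_nth 0%N).
Qed.

Lemma D_nkP (K : comNzRingType) r n k (p : {mpoly K[n]}) :
  D_nk K r n k p <-> exists2 m, m \in descent_exponents r n k & p = 'X_[m].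
Proof.
split=> [[g [e [hd hs ha ->]]]|[m /mem_descent_exponents[g [e [he ->]]] ->]].
  exists (descent_exponent g e); last by rewrite mpolyX_descent_exponent.
  apply/mem_descent_exponents; exists g, e; split=> //.
  by rewrite /descent_data hd hs ha size_tuple eqxx.
have /and4P[hd se hs ha] := he.
by exists g, (Tuple se); split=> //; rewrite -mpolyX_descent_exponent.
Qed.

Section Quotient.
Variables (K : fieldType) (r n k : nat).
Variables (z : 'I_k * 'I_r -> K) (alpha : 'I_k -> K).
Hypothesis z_inj : injective z.
Hypothesis z_pow : forall u, z u ^+ r = alpha u.1.
Hypotheses (r0 : (0 < r)%N) (n0 : (0 < n)%N) (kn : (k <= n)%N).

Local Notation J := (ideal_gen (J_gens K r n k)).
Local Notation proj := (to_S_nk K r n k).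

Lemma proj_linear : linear proj. Proof. exact: pi_gen_quot_is_linear. Qed.

HB.instance Definition _ :=
  GRing.isLinear.Build K {mpoly K[n]} (S_nk K r n k) *:%R proj proj_linear.

Lemma proj_eq (p q : {mpoly K[n]}) : proj p = proj q <-> p - q \in J.
Proof. exact: pi_eq. Qed.

Lemma descent_spans (p : {mpoly K[n]}) :
  exists c : 'X_{1..n} -> K, p - \sum_(m <- descent_exponents r n k) c m *: 'X_[m] \in J.
Proof.
pose Q (p : {mpoly K[n]}) := exists c : 'X_{1..n} -> K,
  p - \sum_(m <- descent_exponents r n k) c m *: 'X_[m] \in J.
have QJ p' : p' \in J -> Q p'.
  by move=> h; exists (fun=> 0); rewrite big1 ?subr0 // => m _; rewrite scale0r.
have QZD a p' q' : Q p' -> Q q' -> Q (a *: p' + q').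
  move=> [c hc] [d hd]; exists (fun m => a * c m + d m).
  rewrite (eq_bigr (fun m => a *: (c m *: 'X_[m]) + d m *: 'X_[m])); last first.
    by move=> m _; rewrite scalerDl scalerA.
  rewrite big_split -scaler_sumr /= opprD addrACA -scalerBr.
  by rewrite rpredD ?ideal_genZ.
rewrite -/(Q p) [p]mpolyE; elim/big_rec: _ => [|m q _]; first exact/QJ/rpred0.
apply: (QZD); apply: (@straighten K r n k Q (mdeg m)) => //.
- exact/QJ/rpred0.
- by move=> p1 p2 h1 h2; rewrite -[p1 - p2]addrC -scaleN1r; apply: QZD.
- move=> g e hge _; set m' := descent_exponent g e.
  have hm : m' \in descent_exponents r n k by apply/mem_descent_exponents; exists g, e.
  exists (fun m => (m == m')%:R); rewrite (bigD1_seq m') ?undup_uniq //= eqxx scale1r.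
  by rewrite big1 ?addr0 ?subrr ?rpred0 // => m1 /negbTE ->; rewrite scale0r.
- by move=> m' D f hf _; apply/QJ/ideal_genMr/mem_ideal_gen/J_generator_mem/hf.
Qed.

Lemma descent_basis : descends_to_basis proj (D_nk K r n k).
Proof.
have dualE := @dual_descent K r n k z alpha z_inj z_pow r0 n0 kn.
have dualJ := @dual_ideal K r n k z alpha z_inj z_pow r0 n0 kn.
split; last split.
- move=> _ _ /D_nkP[m hm ->] /D_nkP[m' hm' ->] /proj_eq /(dualJ _ hm).
  rewrite linearB /= !dualE // eqxx => /eqP; rewrite subr_eq0.
  by case: (m' =P m) => [->|_] //; rewrite oner_eq0.
- move=> N v c v_inj hv hsum i.
  have hm j : exists m, m \in descent_exponents r n k /\ proj 'X_[m] = v j.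
    by have [p /D_nkP[m hm ->] <-] := hv j; exists m.
  pose m j := projT1 (cid (hm j)).
  have [mD mv] : (forall j, m j \in descent_exponents r n k) /\ (forall j, proj 'X_[m j] = v j).
    by split=> j; have [] := projT2 (cid (hm j)).
  have m_inj : injective m by move=> j j' e; apply: v_inj; rewrite -!mv e.
  have : \sum_(j < N) c j *: 'X_[m j] - 0 \in J.
    apply/proj_eq; rewrite linear0 -[RHS]hsum linear_sum; apply: eq_bigr => j _.
    by rewrite linearZ /= mv.
  rewrite subr0 => /(dualJ _ (mD i)); rewrite linear_sum (bigD1 i) //= big1 => [|j nji].
    by rewrite linearZ /= dualE // eqxx mulr1 addr0.
  by rewrite linearZ /= dualE // (inj_eq m_inj) (negbTE nji) mulr0.
- move=> w; have [p ->] : exists p, w = proj p by exists (repr w); rewrite /to_S_nk reprK.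
  have [c /proj_eq ->] := descent_spans p.
  pose D := descent_exponents r n k.
  exists (size D), (fun i => proj 'X_[nth 0%MM D i]), (fun i => c (nth 0%MM D i)).
  split=> [i|].
    by exists 'X_[nth 0%MM D i] => //; apply/D_nkP; exists (nth 0%MM D i); rewrite ?mem_nth.
  rewrite linear_sum (big_nth 0%MM) big_mkord; apply: eq_bigr => i _.
  by rewrite linearZ.
Qed.

End Quotient.

(** Take the products of the integers [1, ..., k] with the [r]-th roots of unity. *)
Lemma distinct_powers_exist (C : numClosedFieldType) (r k : nat) : (0 < r)%N ->
  exists (z : 'I_k * 'I_r -> C) (alpha : 'I_k -> C),
    injective z /\ forall u, z u ^+ r = alpha u.1.
Proof.
move=> r0.
have [s hs] := closed_field_poly_normal ('X^r - 1 : {poly C}).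
rewrite lead_coefXnsubC // scale1r in hs.
have ss : size s == r.
  by have := size_XnsubC (1 : C) r0; rewrite hs size_prod_XsubC => -[->].
have us : uniq s.
  by rewrite -separable_prod_XsubC -hs separable_Xn_sub_1 // pnatr_eq0 -lt0n.
pose w i := tnth (Tuple ss) i.
have w_inj : injective w by apply/tuple_uniqP.
have w1 i : w i ^+ r = 1.
  have : root ('X^r - 1) (w i) by rewrite hs root_prod_XsubC mem_tnth.
  by rewrite /root !hornerE subr_eq0 => /eqP.
exists (fun u : 'I_k * 'I_r => u.1.+1%:R * w u.2), (fun j : 'I_k => j.+1%:R ^+ r).
split=> [[j c] [j' c'] /= e|u]; last by rewrite exprMn w1 mulr1.
have ej : j = j'.
  apply: val_inj; have /eqP := congr1 (fun x => x ^+ r) e.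
  by rewrite !exprMn !w1 !mulr1 eqrXn2 ?ler0n // eqr_nat eqSS => /eqP.
move: e; rewrite ej => /mulfI/w_inj -> //.
by rewrite pnatr_eq0.
Qed.

End Basis.

Theorem theorem5p8 (R : realType) (r n k : nat)
    (hr : 2 <= r) (hn : 1 <= n) (hk : k <= n) :
  descends_to_basis (to_S_nk R[i] r n k) (D_nk R[i] r n k).
Proof.
have r0 : 0 < r by apply: leq_trans hr.
have [z [alpha [z_inj z_pow]]] := distinct_powers_exist R[i] k r0.
exact: descent_basis z_inj z_pow r0 hn hk.
Qed.
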